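(* Let $(A,\ast_1,\circ_1)$ be a pre-Poisson algebra, $E$ a vector space containing $A$ as a subspace, and $(E,\ast,\circ)$ a pre-Poisson algebra such that $A$ is a pre-Poisson subalgebra of $E$. Then there exist a subspace $V$ of $E$ (a complement of $A$ in $E$), a pre-Poisson extending structure $\Omega(A,V)=(l_1,r_1,l_2,r_2,f,\ast_2,\rho_1,\mu_1,\rho_2,\mu_2,g,\circ_2)$ of $A$ through $V$, and an isomorphism of pre-Poisson algebras $(E,\ast,\circ)\cong A\natural V$ that stabilizes $A$ and co-stabilizes $V$.
   Context: All vector spaces and algebras are finite-dimensional over a field $k$. A Zinbiel algebra is a vector space $A$ with a bilinear map $\ast$ such that $x\ast(y\ast z)=(y\ast x)\ast z+(x\ast y)\ast z$. A pre-Lie algebra is a vector space with a bilinear map $\circ$ such that $x\circ(y\circ z)-(x\circ y)\circ z=y\circ(x\circ z)-(y\circ x)\circ z$. A pre-Poisson algebra is a triple $(A,\ast,\circ)$ with $(A,\ast)$ Zinbiel, $(A,\circ)$ pre-Lie, and $(x\circ y-y\circ x)\ast z=x\circ(y\ast z)-y\ast(x\circ z)$ and $(x\ast y+y\ast x)\circ z=x\ast(y\circ z)+y\ast(x\circ z)$ for all $x,y,z$. A pre-Poisson extending datum of $(A,\ast_1,\circ_1)$ through a vector space $V$ is a tuple $\Omega(A,V)=(l_1,r_1,l_2,r_2,f,\ast_2,\rho_1,\mu_1,\rho_2,\mu_2,g,\circ_2)$ of linear maps $l_1,r_1,\rho_1,\mu_1:A\to \mathrm{End}(V)$, $l_2,r_2,\rho_2,\mu_2:V\to\mathrm{End}(A)$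 and bilinear maps $f,g:V\times V\to A$, $\ast_2,\circ_2:V\times V\to V$. $A\natural V$ denotes $A\oplus V$ with $$(a,x)\ast(b,y)=(a\ast_1 b+l_2(x)b+r_2(y)a+f(x,y),\; x\ast_2 y+l_1(a)y+r_1(b)x),$$ $$(a,x)\circ(b,y)=(a\circ_1 b+\rho_2(x)b+\mu_2(y)a+g(x,y),\; x\circ_2 y+\rho_1(a)y+\mu_1(b)x).$$ $\Omega(A,V)$ is a pre-Poisson extending structure if $A\natural V$ with these operations is a pre-Poisson algebra (the unified product). With $E=A\oplus V$ and $\pi:E\to V$ the canonical projection, a linear isomorphism $\varphi:A\natural V\to E$ stabilizes $A$ if $\varphi(a,0)=a$ for all $a\in A$, and co-stabilizes $V$ if $\pi(\varphi(a,x))=x$ for all $a\in A$, $x\in V$. *)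

(* Defs.v *)
From HB Require Import structures.
From mathcomp Require Import all_boot all_algebra.

Set Implicit Arguments.
Unset Strict Implicit.
Unset Printing Implicit Defensive.

Import GRing.Theory.
Local Open Scope ring_scope.

Definition is_zinbiel (k : fieldType) (A : vectType k)
    (mul : {bilinear A -> A -> A}) : Prop :=
  forall x y z : A, mul x (mul y z) = mul (mul y x) z + mul (mul x y) z.

Definition is_prelie (k : fieldType) (A : vectType k)
    (circ : {bilinear A -> A -> A}) : Prop :=
  forall x y z : A,
    circ x (circ y z) - circ (circ x y) z = circ y (circ x z) - circ (circ y x) z.

Record is_prePoisson (k : fieldType) (A : vectType k)
    (mul circ : {bilinear A -> A -> A}) : Prop := IsPrePoisson {
  prePoisson_zinbiel : is_zinbiel mul;
  prePoisson_prelie : is_prelie circ;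
  prePoisson_compat1 : forall x y z : A,
    mul (circ x y - circ y x) z = circ x (mul y z) - mul y (circ x z);
  prePoisson_compat2 : forall x y z : A,
    circ (mul x y + mul y x) z = mul x (circ y z) + mul y (circ x z)
}.

(* The operations [mulA], [circA] of the subspace [A] are the restrictions of
   those of [E]; closure of [A] is implied, as [vsval] takes its values in [A]. *)
Definition is_subalgebra (k : fieldType) (E : vectType k)
    (mulE circE : {bilinear E -> E -> E}) (A : {vspace E})
    (mulA circA : {bilinear subvs_of A -> subvs_of A -> subvs_of A}) : Prop :=
  (forall a b : subvs_of A, vsval (mulA a b) = mulE (vsval a) (vsval b)) /\
  (forall a b : subvs_of A, vsval (circA a b) = circE (vsval a) (vsval b)).

Record extending_datum (k : fieldType) (A V : vectType k) := ExtendingDatum {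
  ed_l1 : 'Hom(A, 'End(V));
  ed_r1 : 'Hom(A, 'End(V));
  ed_l2 : 'Hom(V, 'End(A));
  ed_r2 : 'Hom(V, 'End(A));
  ed_f : {bilinear V -> V -> A};
  ed_mul2 : {bilinear V -> V -> V};
  ed_rho1 : 'Hom(A, 'End(V));
  ed_mu1 : 'Hom(A, 'End(V));
  ed_rho2 : 'Hom(V, 'End(A));
  ed_mu2 : 'Hom(V, 'End(A));
  ed_g : {bilinear V -> V -> A};
  ed_circ2 : {bilinear V -> V -> V}
}.

Section UnifiedProduct.
Variables (k : fieldType) (A V : vectType k).

(* Both operations of the unified product have this shape: [l], [r] act on [V],
   and [l'], [r'] act on [A]. *)
Definition unified_op (op1 : {bilinear A -> A -> A}) (l r : 'Hom(A, 'End(V)))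
    (l' r' : 'Hom(V, 'End(A))) (h : {bilinear V -> V -> A})
    (op2 : {bilinear V -> V -> V}) (p q : A * V) : A * V :=
  (op1 p.1 q.1 + l' p.2 q.1 + r' q.2 p.1 + h p.2 q.2,
   op2 p.2 q.2 + l p.1 q.2 + r q.1 p.2).

Fact unified_op_is_bilinear op1 l r l' r' h op2 :
  bilinear_for *:%R *:%R (unified_op op1 l r l' r' h op2).
Proof.
have lc4 (W : vectType k) (c : k) (a1 a2 a3 a4 b1 b2 b3 b4 : W) :
    (c *: a1 + b1) + (c *: a2 + b2) + (c *: a3 + b3) + (c *: a4 + b4) =
    c *: (a1 + a2 + a3 + a4) + (b1 + b2 + b3 + b4).
  by rewrite !scalerDr [RHS]addrACA [X in _ = X + _]addrACA
             [X in _ = X + _ + _]addrACA.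
have lc3 (W : vectType k) (c : k) (a1 a2 a3 b1 b2 b3 : W) :
    (c *: a1 + b1) + (c *: a2 + b2) + (c *: a3 + b3) =
    c *: (a1 + a2 + a3) + (b1 + b2 + b3).
  by rewrite !scalerDr [RHS]addrACA [X in _ = X + _]addrACA.
have lfP (W W' : vectType k) (m : 'Hom(W, 'End(W'))) (c : k) u v w :
    m (c *: u + v) w = c *: m u w + m v w.
  by rewrite linearP add_lfunE scale_lfunE.
split=> p c q s; rewrite /unified_op; apply: (f_equal2 pair) => /=.
- by rewrite linearPl lfP linearP linearPl lc4.
- by rewrite linearPl lfP linearP lc3.
- by rewrite linearPr linearP lfP linearPr lc4.
- by rewrite linearPr linearP lfP lc3.
Qed.

HB.instance Definition _ op1 l r l' r' h op2 :=
  bilinear_isBilinear.Build k (A * V)%type (A * V)%type (A * V)%type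
    *:%R *:%R (unified_op op1 l r l' r' h op2)
    (unified_op_is_bilinear op1 l r l' r' h op2).

Definition unified_mul (mulA : {bilinear A -> A -> A})
    (Omega : extending_datum A V) :
    {bilinear (A * V)%type -> (A * V)%type -> (A * V)%type} :=
  unified_op mulA (ed_l1 Omega) (ed_r1 Omega) (ed_l2 Omega) (ed_r2 Omega)
    (ed_f Omega) (ed_mul2 Omega).

Definition unified_circ (circA : {bilinear A -> A -> A})
    (Omega : extending_datum A V) :
    {bilinear (A * V)%type -> (A * V)%type -> (A * V)%type} :=
  unified_op circA (ed_rho1 Omega) (ed_mu1 Omega) (ed_rho2 Omega) (ed_mu2 Omega)
    (ed_g Omega) (ed_circ2 Omega).

Definition is_extending_structure (mulA circA : {bilinear A -> A -> A})
    (Omega : extending_datum A V) : Prop :=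
  is_prePoisson (unified_mul mulA Omega) (unified_circ circA Omega).

End UnifiedProduct.

Definition is_prePoisson_iso (k : fieldType) (B C : vectType k)
    (mulB circB : {bilinear B -> B -> B}) (mulC circC : {bilinear C -> C -> C})
    (phi : 'Hom(B, C)) : Prop :=
  [/\ bijective phi,
      forall x y : B, phi (mulB x y) = mulC (phi x) (phi y)
    & forall x y : B, phi (circB x y) = circC (phi x) (phi y)].

Definition is_complement (k : fieldType) (E : vectType k) (A V : {vspace E}) :
    Prop :=
  (A + V = fullv)%VS /\ (A :&: V = 0)%VS.

Definition canonical_proj (k : fieldType) (E : vectType k) (A V : {vspace E})
    (e : E) : subvs_of V :=
  vsproj V (daddv_pi V A e).

Definition stabilizes (k : fieldType) (E : vectType k) (A V : {vspace E})
    (phi : 'Hom((subvs_of A * subvs_of V)%type, E)) : Prop :=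
  forall a : subvs_of A, phi (a, 0) = vsval a.

Definition costabilizes (k : fieldType) (E : vectType k) (A V : {vspace E})
    (phi : 'Hom((subvs_of A * subvs_of V)%type, E)) : Prop :=
  forall (a : subvs_of A) (x : subvs_of V), canonical_proj A V (phi (a, x)) = x.

(* Main.v *)
From HB Require Import structures.
Require Import Defs.
From mathcomp Require Import all_boot all_algebra.

Import GRing.Theory.
Local Open Scope ring_scope.

(** Choosing a complement [V] of [A] splits [E]: every [e] is the sum of its
    [A]-part and its [V]-part, so [phi (a, x) = a + x] is a linear bijection
    from [A * V] onto [E].  An operation of [E] expands by bilinearity into

      [(a + x) (b + y) = a b + x b + a y + x y],

    where [a b] stays in [A] because [A] is a subalgebra, while each of the
    other three products is cut into its [A]-part and its [V]-part.  These six
    parts are the maps of an extending datum: [x b] gives [l2] and [r1], [a y]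
    gives [r2] and [l1], and [x y] gives [f] and the product of [V]; with
    this choice [phi] carries the unified operation to the operation of [E] by
    construction ([splitting_map_morph]).

    The unified product is then a pre-Poisson algebra for free: the axioms are
    identities between bilinear expressions, hence pull back along an injective
    linear map that preserves both operations ([is_prePoisson_inj]).
    Stabilization and co-stabilization hold because [phi] is the inclusion on
    [A] and [pi] kills [A] and restricts to the identity on [V]. *)

Section BilinearMaps.
Context {k : fieldType} {U W X : vectType k}.

Section Curry.
Variable b : {bilinear U -> W -> X}.

Definition curry_fun (u : U) : 'Hom(W, X) := linfun (b u).

Fact curry_fun_is_linear : linear curry_fun.
Proof.
by move=> c u v; apply/lfunP=> w; rewrite add_lfunE scale_lfunE !lfunE /= linearPl.
Qed.

HB.instance Definition _ :=
  GRing.isLinear.Build k U 'Hom(W, X) *:%R curry_fun curry_fun_is_linear.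

Definition curry_hom : 'Hom(U, 'Hom(W, X)) := linfun curry_fun.

Lemma curry_homE u w : curry_hom u w = b u w.
Proof. by rewrite !lfunE. Qed.

Definition flip_bilinear (w : W) (u : U) : X := b u w.

Fact flip_bilinear_is_bilinear : bilinear_for *:%R *:%R flip_bilinear.
Proof. by split=> z c x y; rewrite /flip_bilinear (linearPl, linearPr). Qed.

HB.instance Definition _ :=
  bilinear_isBilinear.Build k W U X *:%R *:%R flip_bilinear
    flip_bilinear_is_bilinear.
End Curry.

Section Transport.
Context {E F G : vectType k}.
Variables (b : {bilinear E -> F -> G}).
Variables (i : 'Hom(U, E)) (j : 'Hom(W, F)) (p : 'Hom(G, X)).

Definition transport_bilinear (u : U) (w : W) : X := p (b (i u) (j w)).

Fact transport_bilinear_is_bilinear : bilinear_for *:%R *:%R transport_bilinear.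
Proof.
by split=> z c x y; rewrite /transport_bilinear linearP (linearPl, linearPr) linearP.
Qed.

HB.instance Definition _ :=
  bilinear_isBilinear.Build k U W X *:%R *:%R transport_bilinear
    transport_bilinear_is_bilinear.
End Transport.

End BilinearMaps.

Lemma is_prePoisson_inj {k : fieldType} {B C : vectType k}
    {mulB circB : {bilinear B -> B -> B}} {mulC circC : {bilinear C -> C -> C}}
    {phi : 'Hom(B, C)} :
  injective phi ->
  {morph phi : x y / mulB x y >-> mulC x y} ->
  {morph phi : x y / circB x y >-> circC x y} ->
  is_prePoisson mulC circC -> is_prePoisson mulB circB.
Proof.
move=> phi_inj phiM phiC [zinb prel compat1 compat2].
split=> x y z; apply: phi_inj.
- by rewrite linearD /= !phiM.
- by rewrite !linearB /= !phiC.
- by rewrite linearB /= !(phiM, phiC) linearB /= !phiC compat1.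
- by rewrite linearD /= !(phiM, phiC) linearD /= !phiM compat2.
Qed.

(** [E] is presented as a direct sum by inclusions and projections, so that
    [A] and [V] may be any spaces. *)
Section Splitting.
Context {k : fieldType} {E A V : vectType k}.
Variables (iA : 'Hom(A, E)) (iV : 'Hom(V, E)).
Variables (pA : 'Hom(E, A)) (pV : 'Hom(E, V)).

Definition splitting_map : 'Hom((A * V)%type, E) :=
  linfun ((iA \o fst) \+ (iV \o snd)).

Lemma splitting_mapE p : splitting_map p = iA p.1 + iV p.2.
Proof. by rewrite lfunE. Qed.

Section Actions.
Variable b : {bilinear E -> E -> E}.

Definition left_action_V : 'Hom(A, 'End(V)) :=
  curry_hom (transport_bilinear b iA iV pV).
Definition right_action_V : 'Hom(A, 'End(V)) :=
  curry_hom (flip_bilinear (transport_bilinear b iV iA pV)).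
Definition left_action_A : 'Hom(V, 'End(A)) :=
  curry_hom (transport_bilinear b iV iA pA).
Definition right_action_A : 'Hom(V, 'End(A)) :=
  curry_hom (flip_bilinear (transport_bilinear b iA iV pA)).
Definition cocycle : {bilinear V -> V -> A} := transport_bilinear b iV iV pA.
Definition op_V : {bilinear V -> V -> V} := transport_bilinear b iV iV pV.
End Actions.

Definition splitting_datum (mulE circE : {bilinear E -> E -> E}) :
    extending_datum A V :=
  ExtendingDatum
    (left_action_V mulE) (right_action_V mulE)
    (left_action_A mulE) (right_action_A mulE) (cocycle mulE) (op_V mulE)
    (left_action_V circE) (right_action_V circE)
    (left_action_A circE) (right_action_A circE) (cocycle circE) (op_V circE).

Hypothesis splitE : forall e, iA (pA e) + iV (pV e) = e.

(** The product of [A] needs no correction term because [iA] preserves it;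
    the other three products are recovered from their two parts by [splitE]. *)
Lemma splitting_map_morph {b : {bilinear E -> E -> E}}
    {opA : {bilinear A -> A -> A}} :
  {morph iA : x y / opA x y >-> b x y} ->
  {morph splitting_map : p q /
     unified_op opA (left_action_V b) (right_action_V b)
       (left_action_A b) (right_action_A b) (cocycle b) (op_V b) p q
     >-> b p q}.
Proof.
move=> iA_morph [a x] [a' y]; rewrite !splitting_mapE /unified_op /=.
rewrite !curry_homE /= /flip_bilinear /transport_bilinear.
rewrite linearDl /= !linearDr /= !linearD /= iA_morph.
set e1 := b (iV x) (iA a'); set e2 := b (iA a) (iV y); set e3 := b (iV x) (iV y).
(* Terms 2 to 4 are the [A]-parts of [e1], [e2], [e3], terms 5 to 7 the
   [V]-parts of [e3], [e2], [e1]. *)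
by rewrite [LHS](AC (4*3) ((1*(3*6))*((2*7)*(4*5)))) /= !splitE.
Qed.

Hypotheses (pA_iA : cancel iA pA) (pV_iV : cancel iV pV).
Hypotheses (pA_iV : forall x, pA (iV x) = 0) (pV_iA : forall a, pV (iA a) = 0).

Lemma splitting_map_bij : bijective splitting_map.
Proof.
exists (fun e => (pA e, pV e)) => [[a x]|e]; rewrite splitting_mapE //=.
by rewrite !linearD /= pA_iA pA_iV pV_iA pV_iV addr0 add0r.
Qed.

Lemma splitting_map_iso {mulE circE : {bilinear E -> E -> E}}
    {mulA circA : {bilinear A -> A -> A}} :
  {morph iA : x y / mulA x y >-> mulE x y} ->
  {morph iA : x y / circA x y >-> circE x y} ->
  is_prePoisson_iso (unified_mul mulA (splitting_datum mulE circE))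
    (unified_circ circA (splitting_datum mulE circE)) mulE circE splitting_map.
Proof.
move=> iA_mul iA_circ; split; first exact: splitting_map_bij.
  exact: splitting_map_morph iA_mul.
exact: splitting_map_morph iA_circ.
Qed.

End Splitting.

Lemma daddv_pi_eq0 {k : fieldType} {E : vectType k} {A V : {vspace E}} {v : E} :
  (A :&: V = 0)%VS -> v \in V -> daddv_pi A V v = 0.
Proof.
move=> capAV vV; have capVA : (V :&: A = 0)%VS by rewrite capvC.
have vVA : v \in (V + A)%VS by rewrite -[v]addr0 memv_add ?mem0v.
apply: (addrI v); rewrite addr0 -[RHS](daddv_pi_add capVA vVA).
by rewrite (daddv_pi_id capVA vV).
Qed.

Theorem theorem2p21 (k : fieldType) (E : vectType k)
    (mulE circE : {bilinear E -> E -> E}) (A : {vspace E})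
    (mulA circA : {bilinear subvs_of A -> subvs_of A -> subvs_of A}) :
  is_prePoisson mulA circA ->
  is_prePoisson mulE circE ->
  is_subalgebra mulE circE mulA circA ->
  exists V : {vspace E},
    is_complement A V /\
    exists Omega : extending_datum (subvs_of A) (subvs_of V),
      is_extending_structure mulA circA Omega /\
      exists phi : 'Hom((subvs_of A * subvs_of V)%type, E),
        [/\ is_prePoisson_iso (unified_mul mulA Omega) (unified_circ circA Omega)
              mulE circE phi,
            stabilizes phi
          & costabilizes phi].
Proof.
move=> _ prePoissonE [subM subC].
pose V := (A^C)%VS; have capAV : (A :&: V = 0)%VS := capv_compl A.
have capVA : (V :&: A = 0)%VS by rewrite capvC.
pose iA : 'Hom(subvs_of A, E) := linfun vsval.
pose iV : 'Hom(subvs_of V, E) := linfun vsval.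
pose pA : 'Hom(E, subvs_of A) := (linfun (vsproj A) \o daddv_pi A V)%VF.
pose pV : 'Hom(E, subvs_of V) := (linfun (vsproj V) \o daddv_pi V A)%VF.
have iAE a : iA a = vsval a by rewrite lfunE.
have iVE x : iV x = vsval x by rewrite lfunE.
have pAE e : pA e = vsproj A (daddv_pi A V e) by rewrite comp_lfunE lfunE.
have pVE e : pV e = canonical_proj A V e by rewrite comp_lfunE lfunE.
have splitE e : iA (pA e) + iV (pV e) = e.
  rewrite iAE iVE pAE pVE !vsprojK ?memv_pi //.
  by rewrite daddv_pi_add // addv_complf memvf.
have pA_iA : cancel iA pA.
  by move=> a; rewrite pAE iAE daddv_pi_id ?subvsP // vsvalK.
have pV_iV : cancel iV pV.
  by move=> x; rewrite pVE iVE /canonical_proj daddv_pi_id ?subvsP // vsvalK.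
have pA_iV x : pA (iV x) = 0.
  by rewrite pAE iVE daddv_pi_eq0 ?subvsP // linear0.
have pV_iA a : pV (iA a) = 0.
  by rewrite pVE iAE /canonical_proj daddv_pi_eq0 ?subvsP // linear0.
have iA_mul : {morph iA : x y / mulA x y >-> mulE x y}.
  by move=> x y; rewrite !iAE subM.
have iA_circ : {morph iA : x y / circA x y >-> circE x y}.
  by move=> x y; rewrite !iAE subC.
have iso := splitting_map_iso _ _ _ _ splitE pA_iA pV_iV pA_iV pV_iA iA_mul iA_circ.
exists V; split; first by split; rewrite ?addv_complf.
exists (splitting_datum iA iV pA pV mulE circE); split.
  have [bij morphM morphC] := iso.
  exact: is_prePoisson_inj (bij_inj bij) morphM morphC prePoissonE.
exists (splitting_map iA iV); split=> // [a|a x].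
  by rewrite splitting_mapE /= linear0 addr0 iAE.
by rewrite -pVE splitting_mapE /= linearD /= pV_iA pV_iV add0r.
Qed.
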